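(* Let $n\geq 3$ and let $G$ be the fundamental group of a closed aspherical $n$-manifold, or more generally an $n$-dimensional duality group. Then there is no non-trivial splitting of $G$ over a finitely generated group $C$ with more than one end such that all the halfspaces of the splitting are one-ended. Here a non-trivial splitting of $G$ over $C$ means a decomposition of $G$ as an amalgam $G=A*_CB$ with $C\ne A$ and $C\neq B$, or as an HNN extension $G=A*_C$, and its halfspaces are those of the action of $G$ on the corresponding Bass--Serre tree.
   Context: A group $G$ that acts freely and cocompactly on a contractible cell complex (by permuting cells) is a duality group of dimension $n$ if $H^i(G;\mathbb ZG)$ vanishes when $i\neq n$ and is torsion-free (as an abelian group) when $i=n$. Halfspaces of a tree: for an edge $e$ of a tree $T$ with midpoint $\hat e$, a halfspace of $T$ bounded by $\hat e$ is the union of $\hat e$ with one of the two components of $T-\hat e$. Halfspaces of a splitting: let a finitely generated group $G$ act on a simplicial tree $T$ without edge inversions, minimally (no proper invariant subtree), and with finitely generated edge stabilizers. Fix an orbit map $f:G\to VT$, $f(g)=gv$, and a finite generating set $S$ of $G$ such that for every halfspace $\mathfrak h$ of $T$ the induced subgraph of $f^{-1}(\mathfrak h)$ in the Cayley graph $\mathrm{Cay}(G,S)$ is connected (such $S$ exists). These induced subgraphs, with their induced path metrics, are the halfspaces of $G\curvearrowright T$. Up to quasi-isometry they do not depend on $f$ and $S$, so one-endedness of halfspaces is well-defined. A connected locally finite graph is one-ended if it is infinite and for every finite subgraph $K$ the complement of $K$ has exactly one unbounded component; it has more than one end if some finite subgraph has at least two unbounded complementary components. The ends of a finitely generated group are those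 of any of its Cayley graphs with respect to finite generating sets. *)

(* Defs.v *)
From HB Require Import structures.
From mathcomp Require Import all_boot all_order all_algebra.
From mathcomp Require Import finmap.
From mathcomp Require Import all_classical all_reals all_analysis.
From mathcomp.multinomials Require monalg.

Set Implicit Arguments.
Unset Strict Implicit.
Unset Printing Implicit Defensive.

Import Order.TTheory GRing.Theory Num.Theory.
Import numFieldNormedType.Exports.
Import -(notations) monalg.

Local Open Scope classical_set_scope.
Local Open Scope group_scope.
Local Open Scope quotient_scope.

Section Cohomology.
Variables (G : groupType) (M : zmodType) (act : G -> M -> M).

(* Homogeneous cochains: Hom_G(F_k, M) for the standard resolution F_* of Z,
   where F_k is free abelian on the (k+1)-tuples of elements of G. *)
Definition equivariant k (f : ('I_k.+1 -> G) -> M) : Prop :=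
  forall (g : G) (x : 'I_k.+1 -> G), f (fun i => g * x i) = act g (f x).

Definition coboundary k (f : ('I_k.+1 -> G) -> M) (x : 'I_k.+2 -> G) : M :=
  (\sum_(j < k.+2) f (fun i => x (lift j i)) *~ ((-1) ^+ j))%R.

Definition is_cocycle k (f : ('I_k.+1 -> G) -> M) : Prop :=
  equivariant f /\ forall x, coboundary f x = 0%R.

Definition is_coboundary k : (('I_k.+1 -> G) -> M) -> Prop :=
  match k with
  | 0 => fun f => forall x, f x = 0%R
  | j.+1 => fun f => exists2 b : ('I_j.+1 -> G) -> M,
      equivariant b & forall x, f x = coboundary b x
  end.

Definition cohomology_vanishes k : Prop :=
  forall f : ('I_k.+1 -> G) -> M, is_cocycle f -> is_coboundary f.

Definition cohomology_torsion_free k : Prop :=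
  forall (f : ('I_k.+1 -> G) -> M) (m : nat), (0 < m)%N -> is_cocycle f ->
    is_coboundary (fun x => (f x *+ m)%R) -> is_coboundary f.

End Cohomology.

(* The G-module ZG; monalg requires a monoid without non-trivial units in order
   to provide a product on {malg int[G]}, but only the left G-module structure
   is needed here. *)
Definition group_ring (G : groupType) : zmodType := malg G int.

Definition group_ring_act (G : groupType) (g : G) (u : group_ring G) :
    group_ring G :=
  (\sum_(x <- msupp u) mkmalgU (g * x)%g (mcoeff x u))%R.

Section CellComplexes.
Variable R : realType.

Definition closed_disk k : set 'rV[R]_k :=
  [set x | (\sum_j x ord0 j ^+ 2 <= 1)%R].
Definition open_disk k : set 'rV[R]_k :=
  [set x | (\sum_j x ord0 j ^+ 2 < 1)%R].
Definition unit_sphere k : set 'rV[R]_k :=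
  [set x | (\sum_j x ord0 j ^+ 2 = 1)%R].

(* CW structures. Together, these axioms imply that characteristic maps restrict
   to homeomorphisms from open disks onto open cells. *)
Record cell_complex (X : topologicalType) := CellComplex {
  cell : nat -> Type;
  char_map : forall k, cell k -> 'rV[R]_k -> X;
  open_cell k (c : cell k) : set X := char_map c @` @open_disk k;
  closed_cell k (c : cell k) : set X := char_map c @` @closed_disk k;
  cell_hausdorff : hausdorff_space X;
  char_map_continuous : forall k (c : cell k),
    {within @closed_disk k, continuous (char_map c)};
  char_map_injective : forall k (c : cell k),
    {in @open_disk k &, injective (char_map c)};
  open_cells_cover : forall x, exists k (c : cell k), open_cell c x;
  open_cells_disjoint : forall k l (c : cell k) (d : cell l) x,
    open_cell c x -> open_cell d x -> existT cell k c = existT cell l d;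
  closure_finite : forall k (c : cell k),
    exists2 F : set {l : nat & cell l}, finite_set F &
      forall x, @unit_sphere k x -> exists l (d : cell l),
        [/\ (l < k)%N, F (existT cell l d) & open_cell d (char_map c x)];
  weak_topology : forall A : set X,
    (forall k (c : cell k), closed (A `&` closed_cell c)) -> closed A
}.

Definition contractible (X : topologicalType) : Prop :=
  exists (x0 : X) (h : R * X -> X),
    [/\ {within `[0%R, 1%R] `*` [set: X], continuous h},
        forall x, h (0%R, x) = x & forall x, h (1%R, x) = x0].

Record free_cocompact_cellular_action (G : groupType) (X : topologicalType)
    (K : cell_complex X) (a : G -> X -> X) : Prop := {
  action1 : forall x, a 1 x = x;
  actionM : forall g h x, a (g * h) x = a g (a h x);
  action_continuous : forall g, continuous (a g);
  action_cells : forall g k (c : cell K k),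
    exists d : cell K k, a g @` open_cell c = open_cell d;
  action_free : forall g x, a g x = x -> g = 1;
  action_cocompact : exists2 D : set X, compact D &
    forall x, exists g y, D y /\ a g y = x
}.

Definition duality_group (n : nat) (G : groupType) : Prop :=
  [/\ exists (X : topologicalType) (K : cell_complex X) (a : G -> X -> X),
        contractible X /\ free_cocompact_cellular_action K a,
      forall i, i <> n -> cohomology_vanishes (@group_ring_act G) i
    & cohomology_torsion_free (@group_ring_act G) n].

End CellComplexes.

(* A graph is given by a relation e on an ambient type and a set V of vertices,
   on which e induces the adjacency relation. *)
Section Graphs.
Variables (T : Type) (e : T -> T -> Prop).

Fixpoint walk (V : set T) (r : nat) (x y : T) : Prop :=
  match r with
  | 0 => V x /\ x = y
  | r'.+1 => exists z, [/\ V x, e x z & walk V r' z y]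
  end.

Definition connected_graph (V : set T) : Prop :=
  forall x y, V x -> V y -> exists r, walk V r x y.

Definition component (V U : set T) : Prop :=
  exists2 x, V x & U = [set y | exists r, walk V r x y].

(* Boundedness of U refers to the path metric of the graph on V. *)
Definition unbounded (V U : set T) : Prop :=
  forall x r, V x -> exists2 y, U y & forall k, (k <= r)%N -> ~ walk V k x y.

Definition unbounded_complementary_component (V K U : set T) : Prop :=
  component (V `\` K) U /\ unbounded V U.

(* Finite subgraphs are replaced by their vertex sets: removing or keeping the
   finitely many edges between vertices of K does not affect the unbounded
   components of the complement. *)
Definition one_ended (V : set T) : Prop :=
  infinite_set V /\ forall K : set T, K `<=` V -> finite_set K ->
    exists! U, unbounded_complementary_component V K U.

Definition more_than_one_end (V : set T) : Prop :=
  exists K U1 U2 : set T,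
    [/\ K `<=` V, finite_set K, U1 <> U2,
        unbounded_complementary_component V K U1 &
        unbounded_complementary_component V K U2].

End Graphs.

Section Groups.
Variable G : groupType.
Implicit Types (A B C : groupClosed G) (S : seq G).

Definition generates S (H : {pred G}) : Prop :=
  {subset S <= H} /\
  forall A, {subset S <= A} -> {subset H <= A}.

Definition finitely_generated (H : {pred G}) : Prop :=
  exists S, generates S H.

Definition cayley S (x y : G) : Prop :=
  exists2 s, s \in S & y = x * s \/ x = y * s.

Definition group_more_than_one_end C : Prop :=
  exists2 S, generates S C & more_than_one_end (cayley S) [set x | x \in C].

Definition hom_on (A : {pred G}) (H : groupType) (phi : G -> H) : Prop :=
  {in A &, {morph phi : x y / x * y}}.

(* G is the pushout of the inclusions of C into A and B. *)
Definition is_amalgam A B C : Prop :=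
  [/\ {subset C <= A}, {subset C <= B} &
      forall (H : groupType) (phi psi : G -> H),
        hom_on A phi -> hom_on B psi -> {in C, phi =1 psi} ->
        exists! theta : G -> H,
          [/\ {morph theta : x y / x * y}, {in A, theta =1 phi}
            & {in B, theta =1 psi}]].

(* G is the HNN extension of A with stable letter t conjugating C into A. *)
Definition is_hnn A C (t : G) : Prop :=
  [/\ {subset C <= A}, {in C, forall c, t * c * t^-1 \in A} &
      forall (H : groupType) (phi : G -> H) (s : H),
        hom_on A phi ->
        {in C, forall c, s * phi c * s^-1 = phi (t * c * t^-1)} ->
        exists! theta : G -> H,
          [/\ {morph theta : x y / x * y}, {in A, theta =1 phi}
            & theta t = s]].

Inductive splitting :=
  | Amalgam of groupClosed G & groupClosed G & groupClosed G
  | HNN of groupClosed G & groupClosed G & G.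

Definition edge_group (s : splitting) : groupClosed G :=
  match s with Amalgam _ _ C => C | HNN _ C _ => C end.

Definition nontrivial_splitting (s : splitting) : Prop :=
  match s with
  | Amalgam A B C => [/\ is_amalgam A B C, ~ (C =i A) & ~ (C =i B)]
  | HNN A C t => is_hnn A C t
  end.

Definition coset_rel A : rel G := fun x y => x^-1 * y \in A.

Lemma coset_rel_equiv A : equiv_class_of (coset_rel A).
Proof.
split=> [x|x y|y x z]; rewrite /coset_rel.
- by rewrite mulVg gpred1.
- by rewrite -gpredV invgM invgK.
- by move=> xy yz; rewrite -(mulVKg y z) mulgA gpredM.
Qed.

Canonical coset_equiv A := EquivRelPack (coset_rel_equiv A).

Definition lcosets A := {eq_quot coset_rel A}.

End Groups.

Record action_graph (G : groupType) := ActionGraph {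
  vertex : Type;
  edge : Type;
  source : edge -> vertex;
  target : edge -> vertex;
  vertex_act : G -> vertex -> vertex
}.

(* Only halfspaces of Bass--Serre trees are needed, so T is not required to be a
   tree here. Since orbit maps take values in vertices, a halfspace is given by
   its set of vertices: a connected component of T minus an edge d. *)
Section Halfspaces.
Variables (G : groupType) (T : action_graph G).

Definition adjacent_off (d : edge T) (u w : vertex T) : Prop :=
  exists2 d', d' <> d &
    (source d' = u /\ target d' = w) \/ (source d' = w /\ target d' = u).

Definition is_halfspace (h : set (vertex T)) : Prop :=
  exists d, component (adjacent_off d) [set: vertex T] h.

Definition orbit_preimage (v : vertex T) (h : set (vertex T)) : set G :=
  [set g | h (vertex_act g v)].

Definition adapted (v : vertex T) (S : seq G) : Prop :=
  generates S predT /\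
  forall h, is_halfspace h ->
    connected_graph (cayley S) (orbit_preimage v h).

(* Halfspaces are independent of v and of the adapted generating set S up to
   quasi-isometry, hence so is their being one-ended. *)
Definition halfspaces_one_ended : Prop :=
  exists (v : vertex T) (S : seq G), adapted v S /\
    forall h, is_halfspace h -> one_ended (cayley S) (orbit_preimage v h).

End Halfspaces.

Section BassSerre.
Variable G : groupType.

(* Vertices gA and gB; the edge gC joins gA to gB. *)
Definition amalgam_tree (A B C : groupClosed G) : action_graph G := {|
  vertex := (lcosets A + lcosets B)%type;
  edge := lcosets C;
  source := fun d => inl (\pi_(lcosets A) (repr d));
  target := fun d => inr (\pi_(lcosets B) (repr d));
  vertex_act := fun g v => match v with
    | inl x => inl (\pi_(lcosets A) (g * repr x))
    | inr x => inr (\pi_(lcosets B) (g * repr x))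
    end
|}.

(* Vertices gA; the edge gC joins gA to g t^-1 A, as t C t^-1 is contained
   in A. *)
Definition hnn_tree (A C : groupClosed G) (t : G) : action_graph G := {|
  vertex := lcosets A;
  edge := lcosets C;
  source := fun d => \pi_(lcosets A) (repr d);
  target := fun d => \pi_(lcosets A) (repr d * t^-1);
  vertex_act := fun g x => \pi_(lcosets A) (g * repr x)
|}.

Definition bass_serre_tree (s : splitting G) : action_graph G :=
  match s with
  | Amalgam A B C => amalgam_tree A B C
  | HNN A C t => hnn_tree A C t
  end.

End BassSerre.

(* Main.v *)
(* Only the vanishing of H^2(G; ZG) is used. Let X be the set of elements of G
   that an orbit map sends to one side of the base edge, whose stabilizer is C.
   The set X is left C-invariant and, for every g, it differs from X g by
   finitely many cosets C k. As C has more than one end, it has an infinite and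
   coinfinite subset E that is almost invariant under right translations; let F
   be the preimage of E under a left C-equivariant retraction G -> C. The cup
   product of the coboundaries of the indicators of F and X has finite support
   on each orbit, so it is the coboundary of some psi with the same property,
   and 1_F d1_X - psi = d gamma for some gamma : G -> Z. On each side of the
   edge d gamma has finite support on the edges of the Cayley graph, so one-
   endedness makes gamma constant outside a finite set. Comparing both sides
   along the translates of a pair of points by C shows that 1_E is constant
   outside a finite set, a contradiction.

   The tree is handled by means of derivations from G to functions on G,
   obtained by applying the universal property of the splitting to a semidirect
   product. *)
Require Import Defs.
From HB Require Import structures.
From mathcomp Require Import all_boot all_order all_algebra.
From mathcomp Require Import finmap.
From mathcomp Require Import all_classical all_reals all_analysis.
From mathcomp Require Import ring lra.
From mathcomp.multinomials Require monalg.

Set Implicit Arguments.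
Unset Strict Implicit.
Unset Printing Implicit Defensive.

Import Order.TTheory GRing.Theory Num.Theory.
Import -(notations) monalg.

Local Open Scope classical_set_scope.
Local Open Scope group_scope.
Local Open Scope quotient_scope.

(** * Cochains with values in the group ring *)

Lemma sum_delta (T : eqType) (V : nmodType) (s : seq T) (F : T -> V) (w : T) :
  uniq s -> (\sum_(x <- s) F x *+ (x == w) = F w *+ (w \in s))%R.
Proof.
move=> us; have [ws|ws] := boolP (w \in s).
  rewrite (bigD1_seq w) //= eqxx big1 ?addr0 // => x /negPf->.
  by rewrite mulr0n.
rewrite big_seq big1 // => x xs; case: eqP => [xw|//].
by rewrite -xw xs in ws.
Qed.

Section GroupRingCochains.
Variable G : groupType.

Lemma mcoeff_act (g w : G) (u : group_ring G) :
  mcoeff w (group_ring_act g u) = mcoeff (g^-1 * w) u.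
Proof.
rewrite /group_ring_act raddf_sum /=.
under eq_bigr => x _ do rewrite mcoeffU.
have E x : (g * x == w) = (x == g^-1 * w).
  by apply/eqP/eqP => [<-|->]; rewrite ?mulKg ?mulVKg.
under eq_bigr => x _ do rewrite E.
by rewrite sum_delta ?fset_uniq //; case: msuppP.
Qed.

(** Meaningful only for [phi] of finite support: [fset_set] is empty on infinite sets. *)
Definition group_ring_of (phi : G -> int) : group_ring G :=
  (\sum_(w <- fset_set [set w | phi w <> 0%R]) mkmalgU w (phi w))%R.

Lemma mcoeff_group_ring_of (phi : G -> int) (w : G) :
  finite_set [set w | phi w <> 0%R] -> mcoeff w (group_ring_of phi) = phi w.
Proof.
move=> fin; rewrite /group_ring_of raddf_sum /=.
under eq_bigr => x _ do rewrite mcoeffU.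
rewrite sum_delta ?fset_uniq // in_fset_set //.
have [//|] := boolP (w \in [set w | phi w <> 0%R]).
by rewrite notin_setE /= => /contrapT ->; rewrite mul0rn.
Qed.

Definition orbit_finite k (phi : ('I_k -> G) -> int) : Prop :=
  forall x, finite_set [set w | phi (fun i => w * x i) <> 0%R].

Lemma finite_set_invg (A : set G) :
  finite_set [set w | A w^-1] <-> finite_set A.
Proof.
suff fin (B : set G) : finite_set B -> finite_set [set w | B w^-1].
  split=> [|/fin//] /fin; apply: sub_finite_set => w Aw /=.
  by rewrite invgK.
by move=> finB; apply: finite_preimage => // x y _ _ /invg_inj.
Qed.

(* An equivariant cochain with values in ZG is determined by its coefficient at 1,
   which can be any integral cochain whose support meets each orbit in a
   finite set. *)
Lemma vanishing_orbit_finite k (phi : ('I_k.+2 -> G) -> int) :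
  cohomology_vanishes (@group_ring_act G) k.+1 ->
  orbit_finite phi -> (forall x, coboundary phi x = 0%R) ->
  exists2 psi : ('I_k.+1 -> G) -> int,
    orbit_finite psi & forall x, phi x = coboundary psi x.
Proof.
move=> H phi_fin dphi.
(* Equivariance and the prescribed coefficient [phi x] at 1 force the coefficient at [w]. *)
pose f (x : 'I_k.+2 -> G) := group_ring_of (fun w => phi (fun i => w^-1 * x i)).
have fE x w : mcoeff w (f x) = phi (fun i => w^-1 * x i).
  rewrite mcoeff_group_ring_of //.
  exact: (iffRL (finite_set_invg _) (phi_fin x)).
have cob j (h : ('I_j.+1 -> G) -> group_ring G) x w :
    mcoeff w (coboundary h x) = coboundary (fun y => mcoeff w (h y)) x.
  rewrite /coboundary raddf_sum /=; apply: eq_bigr => i _.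
  by rewrite raddfMz.
have [|b bE fb] := H f.
  split.
  - move=> g x; apply/malgP => w; rewrite mcoeff_act !fE.
    congr phi; apply/funext => i.
    by rewrite invgM invgK mulgA.
  move=> x; apply/malgP => w; rewrite cob mcoeff0.
  have := dphi (fun i => w^-1 * x i); rewrite /coboundary => {2}<-.
  by apply: eq_bigr => j _; rewrite fE.
exists (fun x => mcoeff 1 (b x)) => [x|x].
- have -> : [set w | mcoeff 1 (b (fun i => w * x i)) <> 0%R] =
      [set w | [set` msupp (b x)] w^-1].
    apply/seteqP; split=> w /=; rewrite bE mcoeff_act mulg1 -mcoeff_neq0.
      by move=> /eqP.
    by move=> /eqP.
  exact: (iffRL (finite_set_invg [set` msupp (b x)]) (finite_fset _)).
- have := congr1 (mcoeff 1) (fb x); rewrite fE cob => <-.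
  by congr phi; apply/funext => i; rewrite invg1 mul1g.
Qed.

End GroupRingCochains.

Definition simplex (G : groupType) k (s : seq G) (i : 'I_k) : G := nth 1 s i.

Lemma coboundary_triple (G : groupType) (f : ('I_2 -> G) -> int) (x y z : G) :
  coboundary f (@simplex _ 3 [:: x; y; z]) =
  (f (simplex [:: y; z]) - f (simplex [:: x; z])
    + f (simplex [:: x; y]))%R.
Proof.
rewrite /coboundary !big_ord_recl big_ord0 /= !exprS expr0.
have E (j : 'I_3) u v : (fun i : 'I_2 => simplex [:: x; y; z] (lift j i)) =1
    (simplex [:: u; v]) -> f (fun i : 'I_2 => simplex [:: x; y; z] (lift j i)) =
    f (simplex [:: u; v]).
  by move=> /funext ->.
rewrite (E ord0 y z) ?(E (lift ord0 ord0) x z)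
  ?(E (lift ord0 (lift ord0 ord0)) x y);
  try by case=> -[|[|[]]].
by rewrite !mulr1 mulrNN mulr1 mulrNz !mulr1z addr0 addrA.
Qed.

(* The function psi is a primitive of the cup product of the coboundaries of q and
   p, which is also the coboundary of the cochain q . dp; the difference of these
   two primitives is a cocycle on a contractible complex, hence of the form
   d gamma. *)
Lemma cup_product_primitive (G : groupType) (p q : G -> int) :
  cohomology_vanishes (@group_ring_act G) 2 ->
  (forall x y z, finite_set [set w | p (w * y) <> p (w * z) /\
                                     q (w * x) <> q (w * y)]) ->
  exists (psi : G -> G -> int) (gamma : G -> int),
    (forall x y, finite_set [set w | psi (w * x) (w * y) <> 0%R]) /\
    forall x y, (gamma y - gamma x = (p y - p x) * q x - psi x y)%R.
Proof.
move=> H2 fin.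
pose phi (x : 'I_3 -> G) := ((p (x (inord 2)) - p (x (inord 1))) *
  (q (x (inord 1)) - q (x (inord 0))))%R.
have [| |psi psi_fin phiE] := vanishing_orbit_finite (phi := phi) H2.
- move=> x; apply: sub_finite_set
    (fin (x (inord 0)) (x (inord 1)) (x (inord 2))) => w /=.
  rewrite /phi => nz; split=> E; apply: nz; rewrite E subrr.
    by rewrite mul0r.
  by rewrite mulr0.
- move=> x; rewrite /coboundary /phi !big_ord_recl big_ord0 /=.
  have E (j : 'I_4) (i : nat) k (_ : (i < 3)%N) (_ : (k < 4)%N) :
      bump j i = k -> lift j (inord i) = inord k :> 'I_4.
    by move=> ijk; apply: val_inj; rewrite /= !inordK.
  rewrite (E ord0 2%N 3%N) // (E ord0 1%N 2%N) // (E ord0 0%N 1%N) //.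
  rewrite (E (lift ord0 ord0) 2%N 3%N) // (E (lift ord0 ord0) 1%N 2%N) //.
  rewrite (E (lift ord0 ord0) 0%N 0%N) //.
  rewrite (E (lift ord0 (lift ord0 ord0)) 2%N 3%N) //.
  rewrite (E (lift ord0 (lift ord0 ord0)) 1%N 1%N) //.
  rewrite (E (lift ord0 (lift ord0 ord0)) 0%N 0%N) //.
  rewrite (E (lift ord0 (lift ord0 (lift ord0 ord0))) 2%N 2%N) //.
  rewrite (E (lift ord0 (lift ord0 (lift ord0 ord0))) 1%N 1%N) //.
  rewrite (E (lift ord0 (lift ord0 (lift ord0 ord0))) 0%N 0%N) //.
  move: (p _) (p _) (p _) (q _) (q _) (q _) => a b c d e f.
  by rewrite !exprS expr0 !mulN1r !opprK !mulrNz !mulr1z; ring.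
pose psi2 x y := psi (simplex [:: x; y]).
have psi2E x y z :
    ((p z - p y) * (q y - q x) = psi2 y z - psi2 x z + psi2 x y)%R.
  by rewrite -coboundary_triple -phiE /phi /simplex !inordK.
(* The cocycle q dp - psi is integrated along the cone with apex 1: [gamma y] is its value on the
   edge from 1 to [y]. *)
exists psi2, (fun y => ((p y - p 1%g) * q 1%g - psi2 1%g y)%R).
split=> [x y|x y].
- apply: sub_finite_set (psi_fin (simplex [:: x; y])) => w /=.
  rewrite /psi2; congr (psi _ <> _); apply/funext.
  by case=> -[|[|[]]].
- have := psi2E 1 x y.
  move: (psi2 _ _) (psi2 _ _) (psi2 _ _) => a b c; lra.
Qed.

(** * Ends of graphs and groups *)

Section Walks.
Variables (T : Type) (e : T -> T -> Prop).
Hypothesis e_sym : forall x y, e x y -> e y x.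
Implicit Types (V K U : set T).

Lemma walk_start V r x y : walk e V r x y -> V x.
Proof. by case: r => [[]|r [z []]]. Qed.

Lemma walk_end V r x y : walk e V r x y -> V y.
Proof. by elim: r x => [x [Vx <-]//|r IH x [z [_ _ /IH]]]. Qed.

Lemma walk_cat V r r' x y z :
  walk e V r x y -> walk e V r' y z -> walk e V (r + r') x z.
Proof.
elim: r x => [x [_ ->]//|r IH x [u [Vx xu uy]] yz].
by exists u; split=> //; apply: IH.
Qed.

Lemma walk1 V x y : V x -> V y -> e x y -> walk e V 1 x y.
Proof. by move=> Vx Vy xy; exists y. Qed.

Lemma walk_sym V r x y : walk e V r x y -> walk e V r y x.
Proof.
elim: r x => [x [Vx <-]//|r IH x [z [Vx xz zy]]].
rewrite -addn1; apply: walk_cat (IH _ zy) _.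
by apply: walk1 (e_sym xz) => //; apply: walk_start zy.
Qed.

Lemma walk_const V r x y (A : Type) (f : T -> A) :
  (forall u v, V u -> V v -> e u v -> f u = f v) ->
  walk e V r x y -> f x = f y.
Proof.
move=> fE; elim: r x => [x [_ ->]//|r IH x [z [Vx xz zy]]].
by rewrite -(IH _ zy); apply: fE => //; apply: walk_start zy.
Qed.

Lemma component_eq V x y r : walk e V r x y ->
  [set z | exists k, walk e V k x z] = [set z | exists k, walk e V k y z].
Proof.
move=> xy; apply/seteqP; split=> z [k kz].
  by exists (r + k)%N; apply: walk_cat kz; apply: walk_sym.
by exists (r + k)%N; apply: walk_cat kz.
Qed.

End Walks.

Section Ends.
Variables (T : choiceType) (e : T -> T -> Prop).
Hypothesis e_sym : forall x y, e x y -> e y x.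
Implicit Types (V K U : set T).

(** In a connected graph a finite set of vertices lies in some ball around any given vertex. *)
Lemma unbounded_infinite V U : connected_graph e V -> V !=set0 -> U `<=` V ->
  unbounded e V U -> infinite_set U.
Proof.
move=> conV [x Vx] UV unbU /finite_seqP[s Us].
have [r Hr] : exists r, forall y, y \in s ->
    exists2 k, (k <= r)%N & walk e V k x y.
  have {Us} : {subset s <= V}.
    by move=> y ys; rewrite inE; apply: UV; rewrite Us.
  elim: s => [|y s IH] sV; first by exists 0%N.
  have [r Hr] : exists r, forall y, y \in s ->
        exists2 k, (k <= r)%N & walk e V k x y.
    by apply: IH => z zs; apply: sV; rewrite inE zs orbT.
  have [|k xy] := conV x y Vx; first by rewrite -in_setE sV ?mem_head.
  exists (maxn k r) => z; rewrite inE => /predU1P[->|/Hr[l lr xz]].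
    by exists k => //; rewrite leq_maxl.
  by exists l => //; rewrite leq_max lr orbT.
have [y Uy] := unbU x r Vx; have [|k kr xy] := Hr y.
  by move: Uy; rewrite Us.
by move=> /(_ k kr).
Qed.

Hypothesis e_fin : forall x, finite_set [set y | e x y].

Lemma finite_sphere V r x : finite_set [set y | walk e V r x y].
Proof.
elim: r x => [x|r IH x].
  by apply: sub_finite_set (finite_set1 x) => y [_ ->].
have : finite_set (\bigcup_(z in [set y | e x y]) [set y | walk e V r z y]).
  exact: bigcup_finite.
by apply: sub_finite_set => y [z [_ xz zy]]; exists z.
Qed.

Lemma infinite_unbounded V U : infinite_set U -> unbounded e V U.
Proof.
move=> infU x r Vx; apply: contrapT => H; apply: infU.
have : finite_set (\bigcup_(k in `I_r.+1) [set y | walk e V k x y]).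
  by apply: bigcup_finite => // k _; apply: finite_sphere.
apply: sub_finite_set => y Uy; apply: contrapT => Hy; apply: H.
by exists y => // k kr xy; apply: Hy; exists k.
Qed.

(** Let K be the finite set of vertices where [f] jumps along an edge. Then [f] is constant on each
    component of V minus K. Finitely many components arise, as each contains a neighbour of K, so
    infinitely many exceptional values would produce a second unbounded component. *)
Lemma one_ended_almost_constant V (A : Type) (f : T -> A) :
  one_ended e V -> connected_graph e V ->
  finite_set [set x | V x /\ exists y, [/\ V y, e x y & f x <> f y]] ->
  exists a, finite_set [set x | V x /\ f x <> a].
Proof.
set K := [set x | _] => -[_ endV] conV finK.
have KV : K `<=` V by move=> x [].
have [_ [[[x0 [Vx0 Kx0] ->] _] Uuniq]] := endV K KV finK.
have fE u v : (V `\` K) u -> (V `\` K) v -> e u v -> f u = f v.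
  move=> [Vu Ku] [Vv Kv] uv; apply: contrapT => fuv.
  by apply: Ku; split=> //; exists v.
exists (f x0); apply: contrapT => infW.
(* Without jumps [f] is constant on the connected graph V; otherwise [k0] serves as the start of
   walks that leave K. *)
have [K0|/set0P[k0 Kk0]] := eqVneq K set0.
  apply: infW; apply: sub_finite_set (finite_set0 _) => x [Vx] /=; apply.
  have [r] := conV _ _ Vx Vx0.
  by apply: walk_const => u v Vu Vv; apply: fE; rewrite K0 setD0.
pose N := \bigcup_(k in K) [set y | e k y].
have finN : finite_set N by apply: bigcup_finite.
pose W y := [set x | (exists r, walk e (V `\` K) r y x) /\ f x <> f x0].
(* Every x outside K is joined, outside K, to one of the finitely many neighbours
   of K. *)
have [y Wy] : exists y, infinite_set (W y).
  apply: contrapT => finW; apply: infW.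
  have : finite_set (K `|` \bigcup_(y in N) W y).
    rewrite finite_setU; split=> //; apply: bigcup_finite => // y _.
    by apply: contrapT => ?; apply: finW; exists y.
  apply: sub_finite_set => x [Vx fx].
  have [Kx|Kx] := pselect (K x); [by left|right].
  have [r k0x] := conV _ _ (KV _ Kk0) Vx.
  (* The walk is cut after its last visit to K. The first alternative, a walk that avoids K
     altogether, is absurd as [k0] is in K. *)
  have [|[y Ny yx]] : walk e (V `\` K) r k0 x \/
      exists2 y, N y & exists r, walk e (V `\` K) r y x.
    elim: r k0 {Kk0} k0x => [z [_ ->]|r IH z [z' [Vz zz' /IH]]]; first by left.
    move=> [z'x|]; last by right.
    have [Kz|Kz] := pselect (K z).
      by right; exists z'; [exists z|exists r].
    by left; exists z'.
    by move=> k0x'; case: (walk_start k0x') => _ /(_ Kk0).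
  by exists y.
have [x [[r yx] fx]] : W y !=set0.
  by apply/set0P; apply: contra_not_neq Wy => ->.
apply: fx; have VKy := walk_start yx.
have UE := Uuniq [set z | exists r, walk e (V `\` K) r y z] _.
have : [set z | exists r, walk e (V `\` K) r x0 z] x.
  rewrite UE; first by exists r.
  split; first by exists y.
  apply: infinite_unbounded; apply: sub_infinite_set Wy.
  by move=> z [].
by move=> [k x0x]; apply/esym/(walk_const fE x0x).
Qed.

End Ends.

(** * Cayley graphs of subgroups and almost invariant subsets *)

Section CayleyGraphs.
Variable G : groupType.
Implicit Types (C : groupClosed G) (S : seq G).

(** [generates] expresses minimality among subgroups given by boolean predicates, so [P] is made
    boolean classically and packed as such a subgroup. *)
Lemma generates_ind S (H : {pred G}) (P : G -> Prop) : generates S H ->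
  P 1 -> (forall x y, P x -> P y -> P (x * y)) ->
  (forall x, P x -> P x^-1) -> (forall s, s \in S -> P s) ->
  forall x, x \in H -> P x.
Proof.
move=> [_ gen] P1 PM PV PS.
pose A : {pred G} := fun x => `[<P x>].
have A1 : 1 \in A by rewrite unfold_in; apply/asboolP.
have AM : {in A &, forall u v, u * v \in A}.
  by move=> u v; rewrite !unfold_in => /asboolP Pu /asboolP Pv; apply/asboolP/PM.
have AV : {in A, forall u, u^-1 \in A}.
  by move=> u; rewrite !unfold_in => /asboolP Pu; apply/asboolP/PV.
pose B : groupClosed G := HB.pack A (isMul1Closed.Build G A A1)
  (isMulClosed.Build G A AM) (isInvClosed.Build G A AV).
have SB : {subset S <= B}.
  by move=> s sS; rewrite unfold_in; apply/asboolP/PS.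
by move=> x /(gen B SB); rewrite unfold_in => /asboolP.
Qed.

Lemma cayley_sym S x y : cayley S x y -> cayley S y x.
Proof. by move=> [s sS xy]; exists s => //; case: xy; [right|left]. Qed.

Lemma cayleyM S g x y : cayley S x y -> cayley S (g * x) (g * y).
Proof.
by move=> [s sS xy]; exists s => //; case: xy => ->; [left|right]; rewrite mulgA.
Qed.

Lemma finite_cayley S x : finite_set [set y | cayley S x y].
Proof.
have : finite_set ([set x * s | s in [set` S]] `|` [set x * s^-1 | s in [set` S]]).
  by rewrite finite_setU; split; apply: finite_image; apply: finite_seq.
apply: sub_finite_set => y [s sS [->|->]]; first by left; exists s.
by right; exists s => //; rewrite mulgK.
Qed.

Lemma finite_set_mulg (A : set G) c :
  finite_set A -> finite_set [set x | A (x * c)].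
Proof. by move=> finA; apply: finite_preimage => // x y _ _ /mulIg. Qed.

(** Left translation by [C] preserves the graph, so the elements joined to 1 inside [C] form a
    subgroup containing [S]. *)
Lemma generates_connected S C : generates S C ->
  connected_graph (cayley S) [set x | x \in C].
Proof.
move=> gen; set V := [set x | _].
have walkM g r x y : g \in C ->
    walk (cayley S) V r x y -> walk (cayley S) V r (g * x) (g * y).
  move=> gC; elim: r x => [x [Cx <-]|r IH x [z [Cx xz /IH zy]]].
    by split=> //; rewrite /V /= gpredM.
  by exists (g * z); split=> //; [rewrite /V /= gpredM|apply: cayleyM].
have from1 x : x \in C -> exists r, walk (cayley S) V r 1 x.
  apply: (generates_ind (P := fun x => exists r, walk _ V r 1 x) gen)
    => [|y z [k ky] [l lz]|y [k ky]|s sS].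
  - by exists 0%N; split=> //; apply: gpred1.
  - exists (k + l)%N; apply: (walk_cat ky); rewrite -{1}(mulg1 y).
    by apply: walkM => //; apply: walk_end ky.
  - exists k; apply: walk_sym; first exact: cayley_sym.
    rewrite -(mulVg y) -{1}(mulg1 y^-1); apply: walkM => //.
    by rewrite gpredV; apply: walk_end ky.
  - exists 1%N; apply: walk1; [exact: gpred1|exact: gen.1|].
    by exists s => //; left; rewrite mul1g.
move=> x y /from1[k kx] /from1[l ly]; exists (k + l)%N.
by apply: walk_cat ly; apply: walk_sym => //; apply: cayley_sym.
Qed.

(** [E] is one of two unbounded components of the complement of a finite set K, and the other one
    lies outside [E]. Passing from [x] to [x * s] with [s] a generator changes [E] only if [x] or
    [x * s] is in K; the elements of [C] with a finite defect form a subgroup. *)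
Lemma almost_invariant_subset C : group_more_than_one_end C ->
  exists E : G -> bool,
    [/\ infinite_set [set x | x \in C /\ E x],
        infinite_set [set x | x \in C /\ ~~ E x]
      & forall c, c \in C -> finite_set [set x | x \in C /\ E x <> E (x * c)]].
Proof.
move=> [S gen [K [U1 [U2 [KC finK U12 [compU1 unbU1] [compU2 unbU2]]]]]].
set V := [set x | x \in C] in KC compU1 unbU1 compU2 unbU2.
have conV := generates_connected gen.
have V0 : V !=set0 by exists 1; apply: gpred1.
have csym := @cayley_sym S.
have UV U : component (cayley S) (V `\` K) U -> U `<=` V.
  by move=> [x _ ->] y [r xy]; case: (walk_end xy).
exists (fun x => `[<U1 x>]); split.
- have := unbounded_infinite conV V0 (UV _ compU1) unbU1.
  apply: sub_infinite_set => x U1x; split; first exact: UV compU1 _ U1x.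
  exact/asboolP.
- have := unbounded_infinite conV V0 (UV _ compU2) unbU2.
  apply: sub_infinite_set => x U2x; split; first exact: UV compU2 _ U2x.
  apply/asboolP => U1x; apply: U12; case: compU1 compU2 U1x U2x.
  move=> x1 _ -> [x2 _ ->] [r x1x] [k x2x].
  by rewrite (component_eq csym x1x) (component_eq csym x2x).
pose P c := c \in C /\
  finite_set [set x | x \in C /\ `[<U1 x>] <> `[<U1 (x * c)>]].
suff CP c : c \in C -> P c by move=> c /CP[].
apply: (generates_ind (P := P) gen) => [|x y [Cx Px] [Cy Py]|x [Cx Px]|s sS].
- split; first exact: gpred1.
  by apply: sub_finite_set (finite_set0 _) => x [_] /=; rewrite mulg1.
- split; first exact: gpredM.
  have := conj Px (finite_set_mulg x Py); rewrite -finite_setU.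
  apply: sub_finite_set => z [Cz] Ez.
  have [E1|E1] := pselect (`[<U1 z>] = `[<U1 (z * x)>]); last by left.
  by right; split; rewrite ?gpredM // -E1 -mulgA.
- split; first by rewrite gpredV.
  have := finite_set_mulg x^-1 Px.
  apply: sub_finite_set => z [Cz] Ez /=.
  by rewrite gpredM ?gpredV // mulgVK; split=> // E; apply: Ez.
- split; first exact: gen.1.
  have := conj finK (finite_set_mulg s finK); rewrite -finite_setU.
  apply: sub_finite_set => z [Cz] Ez.
  have [|Kz] := pselect (K z); first by left.
  have [|Kzs] := pselect (K (z * s)); [by right|case: Ez].
  have zs : walk (cayley S) (V `\` K) 1 z (z * s).
    apply: walk1; [by []|by split=> //; rewrite /V /= gpredM // gen.1|].
    by exists s => //; left.
  case: compU1 => x _ ->; congr asbool; apply/propext; split=> -[r xr].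
    by exists (r + 1)%N; apply: walk_cat zs.
  by exists (r + 1)%N; apply: walk_cat xr _; apply: walk_sym.
Qed.

End CayleyGraphs.

(** * Sides of an edge *)

Section Halfspaces.
Variable G : groupType.
Implicit Types (C : groupClosed G) (S : seq G).

Lemma lcoset_eq C (x y : G) :
  (\pi_(lcosets C) x == \pi_(lcosets C) y) = (x^-1 * y \in C).
Proof. exact: eqmodE. Qed.

Lemma lcosetM C (x c : G) : c \in C -> \pi_(lcosets C) (x * c) = \pi_(lcosets C) x.
Proof. by move=> Cc; apply/esym/eqP; rewrite lcoset_eq mulKg. Qed.

Lemma repr_lcoset C (x : G) : exists2 c, c \in C & repr (\pi_(lcosets C) x) = x * c.
Proof.
exists (x^-1 * repr (\pi_(lcosets C) x)); last by rewrite mulVKg.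
by rewrite -lcoset_eq reprK.
Qed.

(** Each [x] is written as [r x] times a representative of the right coset of [x], which is obtained
    by inversion from the left coset of [x^-1]. *)
Lemma equivariant_retraction C : exists r : G -> G,
  (forall x, r x \in C) /\ forall c x, c \in C -> r (c * x) = c * r x.
Proof.
exists (fun x => x * repr (\pi_(lcosets C) x^-1)); split=> [x|c x Cc].
  by have [c Cc ->] := repr_lcoset C x^-1; rewrite mulVKg.
by rewrite invgM lcosetM ?gpredV // mulgA.
Qed.

(** [X] and its complement play the two sides of an edge with stabilizer [C]. What remains of the
    tree is the invariance of [X] under [C], its almost invariance up to finitely many cosets [C k],
    and the connectedness of both sides. *)
Lemma halfspaces_not_both_one_ended C S (X : G -> bool) :
  cohomology_vanishes (@group_ring_act G) 2 -> group_more_than_one_end C ->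
  (forall c x, c \in C -> X (c * x) = X x) ->
  (forall g, exists s : seq G, forall x, X (x * g) <> X x ->
     exists2 k, k \in s & x * k^-1 \in C) ->
  (forall b, connected_graph (cayley S) [set x | X x = b]) ->
  ~ (forall b, one_ended (cayley S) [set x | X x = b]).
Proof.
move=> H2 /almost_invariant_subset[E [infE infnE Einv]] CX Xfin conX endX.
have [r [rC rM]] := equivariant_retraction C.
have Einv2 a b : a \in C -> b \in C ->
    finite_set [set c | c \in C /\ E (c * a) <> E (c * b)].
  move=> Ca Cb; have Cab : a^-1 * b \in C by rewrite gpredM ?gpredV.
  have := finite_set_mulg a (Einv _ Cab); apply: sub_finite_set => c [Cc cab].
  by split; rewrite ?gpredM //= -mulgA mulVKg.
have [|psi [gamma [psi_fin gammaE]]] :=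
    @cup_product_primitive G (fun x => Posz (X x)) (fun x => Posz (E (r x))) H2.
  move=> x y z; have [s Xs] := Xfin (y^-1 * z).
  (* If [X] changes between [w * y] and [w * z], then [w * y = c * k] with [c] in [C] and [k] in
     [s]. By equivariance of [r], the other condition compares [E] at two right translates of [c] by
     elements of [C], which differ for finitely many [c]. *)
  pose D k := [set w | [set c | c \in C /\
    E (c * r (k * y^-1 * x)) <> E (c * r k)] (w * (y * k^-1))].
  have : finite_set (\bigcup_(k in [set` s]) D k).
    apply: bigcup_finite => [|k _]; first exact: finite_seq.
    by apply: finite_set_mulg; apply: Einv2.
  apply: sub_finite_set => w [Xyz Exy].
  have [E1|k ks Ck] := Xs (w * y).
    by apply: Xyz; rewrite -E1 -mulgA mulVKg.
  exists k => //; split; rewrite mulgA // => E2.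
  apply: Exy; congr Posz; congr nat_of_bool.
  move: E2; rewrite -!rM // !mulgA mulgVK.
  by rewrite mulgK.
(* On one side of the edge p is constant, so d gamma = - psi, which is nonzero on finitely many
   edges of the Cayley graph. *)
have gamma_const b : exists a, finite_set [set x | X x = b /\ gamma x <> a].
  apply: one_ended_almost_constant (endX b) (conX b) _; first exact: finite_cayley.
  pose D s := [set x | psi (x * 1) (x * s) <> 0%R].
  have : finite_set (\bigcup_(s in [set` S]) (D s `|` D s^-1)).
    apply: bigcup_finite => [|s _]; first exact: finite_seq.
    by rewrite finite_setU; split; apply: psi_fin.
  apply: sub_finite_set => x [Xx [y [Xy [s sS xy] gxy]]].
  have psi_xy : psi x y <> 0%R.
    move=> psi0; apply: gxy; apply/esym/eqP; rewrite -subr_eq0 gammaE.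
    by rewrite Xx Xy subrr mul0r psi0 subr0.
  exists s => //; rewrite /D /= mulg1; case: xy => xy; [left|right].
    by rewrite -xy.
  by rewrite xy mulgK -xy.
have [[a1 fin1] [a0 fin0]] := (gamma_const true, gamma_const false).
have [y0 /= Xy0] : [set x | X x = true] !=set0.
  by apply/set0P; have [inf _] := endX true; apply: contra_not_neq inf => ->.
have [x0 /= Xx0] : [set x | X x = false] !=set0.
  by apply/set0P; have [inf _] := endX false; apply: contra_not_neq inf => ->.
(* For all but finitely many [c], [gamma] is [a1] at [c * y0] and [a0] at [c * x0], and psi vanishes
   on this pair; the formula for d gamma then reads a1 - a0 = E(c r(x0)). *)
have finE : finite_set [set c | c \in C /\ E (c * r x0) <> (a1 - a0 == 1)%R].
  have := conj (finite_set_mulg y0 fin1)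
    (conj (finite_set_mulg x0 fin0) (psi_fin x0 y0)); rewrite -!finite_setU.
  apply: sub_finite_set => c [Cc Ec] /=; apply: contrapT => /not_orP[n1 /not_orP[n0 npsi]].
  apply: Ec; have := gammaE (c * x0) (c * y0).
  rewrite !CX // Xy0 Xx0 rM // (contrapT npsi).
  have -> : gamma (c * y0) = a1.
    by apply: contrapT => n; apply: n1; rewrite CX.
  have -> : gamma (c * x0) = a0.
    by apply: contrapT => n; apply: n0; rewrite CX.
  by rewrite /= !subr0 mul1r => ->; case: (E _).
(* Translation by [r x0], an element of [C], yields that [E] itself is constant on [C] outside a
   finite set. *)
have {}finE := finite_set_mulg (r x0)^-1 finE.
case: eqP finE => _ finE; [apply: infnE|apply: infE];
  apply: sub_finite_set finE => c [Cc Ec] /=;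
  rewrite mulgVK gpredM ?gpredV //; split=> //; [exact/negP|by rewrite Ec].
Qed.

End Halfspaces.

(** * Splittings and derivations *)

Section Twist.
Variable G : groupType.

(* The semidirect product of the left G-module of functions G -> Z with G: the
   homomorphisms G -> twist lifting the identity of G are the derivations. *)
Definition twist : Type := ((G -> int) * G)%type.

HB.instance Definition _ := Choice.copy twist ((G -> int) * G)%type.

Definition twist_mul (u v : twist) : twist :=
  (fun x => (u.1 x + v.1 (u.2^-1 * x)%g)%R, u.2 * v.2).
Definition twist_one : twist := (fun=> 0%R, 1).
Definition twist_inv (u : twist) : twist := (fun x => (- u.1 (u.2 * x)%g)%R, u.2^-1).

Lemma twist_mulA : associative twist_mul.
Proof.
move=> u v w; congr pair; last by rewrite /= mulgA.
by apply/funext => x /=; rewrite addrA invgM mulgA.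
Qed.

Lemma twist_mul1 : left_id twist_one twist_mul.
Proof.
move=> [u g]; congr pair; rewrite /= ?mul1g //.
by apply/funext => x /=; rewrite add0r invg1 mul1g.
Qed.

Lemma twist_mulr1 : right_id twist_one twist_mul.
Proof.
move=> [u g]; congr pair; rewrite /= ?mulg1 //.
by apply/funext => x /=; rewrite addr0.
Qed.

Lemma twist_mulV : left_inverse twist_one twist_inv twist_mul.
Proof.
move=> [u g]; congr pair; rewrite /= ?mulVg //.
by apply/funext => x /=; rewrite invgK addNr.
Qed.

Lemma twist_mulrV : right_inverse twist_one twist_inv twist_mul.
Proof.
move=> [u g]; congr pair; rewrite /= ?mulgV //.
by apply/funext => x /=; rewrite mulVKg subrr.
Qed.

HB.instance Definition _ := isGroup.Build twist
  twist_mulA twist_mul1 twist_mulr1 twist_mulV twist_mulrV.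

Definition derivation (D : G -> G -> int) : Prop :=
  forall g h x, D (g * h) x = (D g x + D h (g^-1 * x)%g)%R.

End Twist.

Section Derivations.
Variable G : groupType.
Implicit Types (A B C : groupClosed G) (D : G -> G -> int).

Lemma derivation1 D : derivation D -> D 1 = fun=> 0%R.
Proof.
move=> derD; apply/funext => x; have := derD 1 1 x.
by rewrite invg1 !mul1g => /eqP; rewrite -subr_eq0 opprD addNKr oppr_eq0 => /eqP.
Qed.

Lemma derivationV D g x : derivation D -> D g^-1 x = (- D g (g * x)%g)%R.
Proof.
move=> derD; have := derD g g^-1 (g * x).
by rewrite mulgV derivation1 // mulKg => /eqP; rewrite eq_sym addrC addr_eq0 => /eqP.
Qed.

Definition inner_derivation (m : G -> int) (g x : G) : int :=
  (m x - m (g^-1 * x)%g)%R.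

Lemma inner_derivationP m : derivation (inner_derivation m).
Proof.
by move=> g h x; rewrite /inner_derivation invgM mulgA addrA subrK.
Qed.

Lemma zero_derivation : derivation (fun _ _ : G => 0%R).
Proof. by move=> g h x; rewrite addr0. Qed.

Lemma twist_hom D : derivation D ->
  {morph (fun g => (D g, g) : twist G) : x y / x * y}.
Proof. by move=> derD x y; congr pair; apply/funext => z; rewrite derD. Qed.

Lemma twist_hom_derivation (theta : G -> twist G) :
  {morph theta : x y / x * y} -> (forall g, (theta g).2 = g) ->
  derivation (fun g => (theta g).1).
Proof. by move=> thM th2 g h x; rewrite thM /= th2. Qed.

(** The zero derivation on [A] and the inner one on [B] agree on [C] because [m] is left
    [C]-invariant, so their lifts to [twist G] glue. *)
Lemma amalgam_derivation A B C (m : G -> int) : is_amalgam A B C ->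
  (forall c x, c \in C -> m (c * x) = m x) ->
  exists D, [/\ derivation D, forall a x, a \in A -> D a x = 0%R
    & forall b, b \in B -> D b = inner_derivation m b].
Proof.
move=> [CA CB univ] mC.
have [||x Cx|theta [[thM thA thB] _]] := univ (twist G)
    (fun g => (fun=> 0%R, g)) (fun g => (inner_derivation m g, g)).
- by move=> x y _ _; apply: (twist_hom zero_derivation).
- by move=> x y _ _; apply: (twist_hom (inner_derivationP m)).
- congr pair; apply/funext => y.
  by rewrite /inner_derivation mC ?gpredV // subrr.
(* The second component fixes [A] and [B] pointwise, hence is the identity by uniqueness with target
   [G]. *)
have th2 : (fun g => (theta g).2) = id.
  have [|||t [_ tuniq]] := univ G id id; try by [].
  rewrite -(tuniq id) //; apply/esym/tuniq; split=> [x y|x Ax|x Bx].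
  - by rewrite thM.
  - by rewrite thA.
  - by rewrite thB.
exists (fun g => (theta g).1); split.
- by apply: twist_hom_derivation => // g; rewrite -[RHS]/(id g) -th2.
- by move=> a x Aa; rewrite thA.
- by move=> b Bb; rewrite thB.
Qed.

(** Inversion turns invariance of [P] under right multiplication into invariance under left
    translation, which inner derivations detect. *)
Definition inv_indicator (P : G -> Prop) (x : G) : int := Posz `[< P x^-1 >].

Lemma inv_indicatorM (P : G -> Prop) g x : (forall y, P y <-> P (y * g)) ->
  inv_indicator P (g^-1 * x) = inv_indicator P x.
Proof.
move=> PM; rewrite /inv_indicator invgM invgK.
congr (Posz (nat_of_bool _)); congr asbool.
by apply/propext; have := PM x^-1; tauto.
Qed.

Lemma inner_inv_indicator_ind (P : G -> Prop) :
  (fun g => (fun=> 0%R, g) : twist G) =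
    (fun g => (inner_derivation (inv_indicator P) g, g)) ->
  P 1 -> forall x, P x.
Proof.
move=> E P1 g; have := congr1 (fun u => (u g).1 1) E.
rewrite /= /inner_derivation /inv_indicator mulg1 invgK invg1 => /esym/eqP.
by rewrite subr_eq0 (asboolT P1) => /eqP[]; case: asboolP.
Qed.

(* Uniqueness in the universal property, applied to the zero derivation and to the
   inner derivation of the indicator of P. *)
Lemma amalgam_ind A B C (P : G -> Prop) : is_amalgam A B C ->
  P 1 -> (forall x a, a \in A -> P x -> P (x * a)) ->
  (forall x b, b \in B -> P x -> P (x * b)) -> forall x, P x.
Proof.
move=> [CA CB univ] P1 PA PB; apply: inner_inv_indicator_ind => //.
set m := inv_indicator P.
have mM (H : groupClosed G) h :
    (forall x a, a \in H -> P x -> P (x * a)) -> h \in H ->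
    (fun=> 0%R, h) = (inner_derivation m h, h) :> twist G.
  move=> PH Hh; congr pair; apply/funext => x.
  rewrite /inner_derivation /m inv_indicatorM ?subrr // => y.
  split=> [|/(PH _ h^-1)]; first exact: PH.
  by rewrite gpredV mulgK; apply.
have [|||theta [_ theta_uniq]] := univ (twist G)
    (fun g => (fun=> 0%R, g)) (fun g => (fun=> 0%R, g)).
- by move=> x y _ _; apply: (twist_hom zero_derivation).
- by move=> x y _ _; apply: (twist_hom zero_derivation).
- by [].
rewrite -(theta_uniq (fun g => (fun=> 0%R, g))).
  apply: theta_uniq; split; first exact: (twist_hom (inner_derivationP m)).
  - by move=> a Aa; rewrite (mM A).
  - by move=> b Bb; rewrite (mM B).
by split=> //; apply: (twist_hom zero_derivation).
Qed.

(** With D zero on [A] and D(t^-1) = m, the value of D on t c t^-1 is t(c m - m), which vanishes, as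
    the relation requires, by the left [C]-invariance of [m]. *)
Lemma hnn_derivation A C t (m : G -> int) : is_hnn A C t ->
  (forall c x, c \in C -> m (c * x) = m x) ->
  exists D, [/\ derivation D, forall a x, a \in A -> D a x = 0%R
    & D t^-1 = m].
Proof.
move=> [CA tCA univ] mC.
have [||theta [[thM thA tht] _]] := univ (twist G)
    (fun g => (fun=> 0%R, g)) (fun x => (- m (t^-1 * x)%g)%R, t).
- by move=> x y _ _; apply: (twist_hom zero_derivation).
- move=> c Cc; apply: (canLR (mulgK _)); congr pair; last by rewrite /= mulgVK.
  apply/funext => y /=; rewrite addr0 add0r !invgM invgK !mulgA mulVg mul1g.
  by rewrite -mulgA (mC c^-1) ?gpredV.
have th2 : (fun g => (theta g).2) = id.
  have [||u [_ uuniq]] := univ G id t; try by [].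
  rewrite -(uuniq id) //; apply/esym/uuniq; split=> [x y|x Ax|].
  - by rewrite thM.
  - by rewrite thA.
  - by rewrite tht.
have derD : derivation (fun g => (theta g).1).
  by apply: twist_hom_derivation => // g; rewrite -[RHS]/(id g) -th2.
exists (fun g => (theta g).1); split=> [//|a x Aa|]; first by rewrite thA.
by apply/funext => x; rewrite (derivationV t x derD) tht /= opprK mulKg.
Qed.

(** By uniqueness, the inner derivation of the indicator of [P] is zero since it vanishes on [A] and
    at [t]. For [A] one implication suffices, as [A] contains inverses; for [t^-1] both are
    assumed. *)
Lemma hnn_ind A C t (P : G -> Prop) : is_hnn A C t ->
  P 1 -> (forall x a, a \in A -> P x -> P (x * a)) ->
  (forall x, P x <-> P (x * t^-1)) -> forall x, P x.
Proof.
move=> [CA tCA univ] P1 PA Pt; apply: inner_inv_indicator_ind => //.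
set m := inv_indicator P.
have mM g : (forall x, P x <-> P (x * g)) ->
    (fun=> 0%R, g) = (inner_derivation m g, g) :> twist G.
  move=> Pg; congr pair; apply/funext => x.
  by rewrite /inner_derivation /m inv_indicatorM ?subrr.
have [||theta [_ theta_uniq]] := univ (twist G) (fun g => (fun=> 0%R, g)) (fun=> 0%R, t).
- by move=> x y _ _; apply: (twist_hom zero_derivation).
- move=> c Cc; apply: (canLR (mulgK _)).
  by rewrite -!(twist_hom zero_derivation) mulgVK.
rewrite -(theta_uniq (fun g => (fun=> 0%R, g))).
  apply: theta_uniq; split; first exact: (twist_hom (inner_derivationP m)).
  - move=> a Aa; rewrite -mM // => x.
    split=> [|/(PA _ a^-1)]; first exact: PA.
    by rewrite gpredV mulgK; apply.
  - by rewrite -mM // => x; have := Pt (x * t); rewrite mulgK; tauto.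
by split=> //; apply: (twist_hom zero_derivation).
Qed.

End Derivations.

(** * Bass--Serre trees *)

Section Trees.
Variable G : groupType.
Implicit Types (A B C : groupClosed G) (u : G -> int).

(* u is an element of Z[G/C]. *)
Definition coset_supported C u : Prop :=
  (forall x c, c \in C -> u (x * c) = u x) /\
  exists s : seq G, forall x, u x <> 0%R -> exists2 k, k \in s & k^-1 * x \in C.

Lemma coset_supported0 C : coset_supported C (fun=> 0%R).
Proof. by split=> //; exists [::]. Qed.

Lemma coset_supportedN C u :
  coset_supported C u -> coset_supported C (fun x => - u x)%R.
Proof.
move=> [uC [s us]]; split=> [x c Cc|]; first by rewrite uC.
by exists s => x ux; apply: us => u0; apply: ux; rewrite u0 oppr0.
Qed.

Lemma coset_supportedD C u v : coset_supported C u -> coset_supported C v ->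
  coset_supported C (fun x => u x + v x)%R.
Proof.
move=> [uC [s us]] [vC [r vr]]; split=> [x c Cc|]; first by rewrite uC ?vC.
exists (s ++ r) => x uvx; have [ux|/eqP/us[k ks kx]] := eqVneq (u x) 0%R.
  have [k kr kx] : exists2 k, k \in r & k^-1 * x \in C.
    by apply: vr => vx; apply: uvx; rewrite ux vx.
  by exists k => //; rewrite mem_cat kr orbT.
by exists k => //; rewrite mem_cat ks.
Qed.

Lemma coset_supportedM C u g :
  coset_supported C u -> coset_supported C (fun x => u (g^-1 * x)).
Proof.
move=> [uC [s us]]; split=> [x c Cc|]; first by rewrite mulgA uC.
exists [seq g * k | k <- s] => x /us[k ks kx].
by exists (g * k); rewrite ?map_f // invgM -mulgA.
Qed.

Definition indicator C (x : G) : int := Posz (x \in C).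

Lemma coset_supported_indicator C : coset_supported C (indicator C).
Proof.
split=> [x c Cc|]; first by rewrite /indicator gpredMr.
exists [:: 1] => x; rewrite /indicator; have [Cx _|//] := boolP (x \in C).
by exists 1; rewrite ?inE // invg1 mul1g.
Qed.

(* In a Bass--Serre tree, chi v is the number of crossings of d0, counted with sign,
   on a path from a base vertex to v, and D g x is the number of crossings of x d0
   on a path from the base vertex to its image under g. *)
Lemma tree_halfspaces_not_one_ended C (T : action_graph G) (d0 : edge T)
    (chi : vertex T -> int) (D : G -> G -> int) (u : vertex T -> G -> int) :
  cohomology_vanishes (@group_ring_act G) 2 -> group_more_than_one_end C ->
  (forall W : set (vertex T), W (source d0) ->
     (forall d, W (source d) <-> W (target d)) -> forall v, W v) ->
  chi (source d0) = 0%R -> chi (target d0) = 1%R ->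
  (forall d, d <> d0 -> chi (source d) = chi (target d)) ->
  derivation D -> (forall c x, c \in C -> D c x = 0%R) ->
  (forall g, coset_supported C (D g)) -> (forall v, coset_supported C (u v)) ->
  (forall g v, chi (vertex_act g v) = (D g 1%g + u v g^-1%g)%R) ->
  ~ halfspaces_one_ended T.
Proof.
move=> H2 endsC conn chi0 chi1 chiE derD DC Dsupp usupp chi_act [v [S [[_ adS] endS]]].
pose U w := [set y | exists r, walk (adjacent_off d0) [set: vertex T] r w y].
have adj_sym x y : adjacent_off d0 x y -> adjacent_off d0 y x.
  by move=> [d dd0 xy]; exists d => //; tauto.
have chiU w y : U w y -> chi w = chi y.
  move=> [r wy]; apply: (walk_const _ wy) => x z _ _ [d dd0].
  by have := chiE d dd0 => + [] [<- <-] => ->.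
have U_closed w x y : adjacent_off d0 x y -> U w x -> U w y.
  by move=> xy [r wx]; exists (r + 1)%N; apply: (walk_cat (y := x)) => //; apply: walk1.
have U0 w : U w w by exists 0%N.
(* The tree being connected, removing [d0] leaves at most the components of its two endpoints; [chi]
   tells them apart. *)
have cover y : U (source d0) y \/ U (target d0) y.
  apply: (conn (U (source d0) `|` U (target d0))) => [|d]; first by left.
  have [->|dd0] := pselect (d = d0).
    by split=> _; [right|left].
  have sd : adjacent_off d0 (source d) (target d) by exists d => //; left.
  split=> -[]; do ?[by move/(U_closed _ _ _ sd); by [left|right]];
    by move/(U_closed _ _ _ (adj_sym _ _ sd)); by [left|right].
pose X g := chi (vertex_act g v) == 1%R.
have XE b : [set g | X g = b] =
    orbit_preimage v (U (if b then target d0 else source d0)).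
  apply/seteqP; split=> g /=; rewrite /orbit_preimage /X /=.
    move=> <-; case: (cover (vertex_act g v)) => Ug.
      by rewrite -(chiU _ _ Ug) chi0.
    by rewrite -(chiU _ _ Ug) chi1.
  by move=> /chiU <-; case: b; rewrite ?chi1 ?chi0.
have halfspaceU b : is_halfspace (U (if b then target d0 else source d0)).
  by exists d0; exists (if b then target d0 else source d0).
apply: (@halfspaces_not_both_one_ended G C S X H2 endsC) => [c x Cc|g|b|b].
- rewrite /X !chi_act derD DC // add0r invgM mulg1.
  rewrite (usupp v).1 ?gpredV // -[c^-1]mul1g.
  by rewrite (Dsupp x).1 ?gpredV.
(* The change of [chi] from [x v] to [x g v] is the value at [x^-1] of D(g) + g u(v) - u(v), an
   element of Z[G/C]. Inversion turns its cosets [k C] into [C k^-1]. *)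
- have := coset_supportedD (Dsupp g)
    (coset_supportedD (coset_supportedM g (usupp v)) (coset_supportedN (usupp v))).
  move=> [_ [s Hs]]; exists [seq k^-1 | k <- s] => x Xx.
  have [|k ks kx] := Hs x^-1; last first.
    exists k^-1; first exact: (map_f (fun k => k^-1)).
    by rewrite -gpredV invgM invgK.
  move=> E; apply: Xx; rewrite /X !chi_act derD mulg1 invgM.
  by congr (_ == _); apply/eqP; rewrite -subr_eq0 -E; apply/eqP; ring.
- by rewrite XE; apply: adS.
- by rewrite XE; apply: endS.
Qed.

(** The base vertex is [A], which its stabilizer fixes, so D is zero there. For [b] in [B], the path
    from [A] to [bA] through [B] crosses [C] and then [bC] backwards, so D(b) is inner for the
    indicator of [C]. *)
Lemma amalgam_halfspaces_not_one_ended A B C :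
  cohomology_vanishes (@group_ring_act G) 2 -> group_more_than_one_end C ->
  is_amalgam A B C -> ~ halfspaces_one_ended (amalgam_tree A B C).
Proof.
move=> H2 endsC amal; have [CA CB _] := amal.
have mC c x : c \in C -> indicator C (c * x) = indicator C x.
  by move=> Cc; rewrite /indicator gpredMl.
have [D [derD DA DB]] := amalgam_derivation amal mC.
pose chi (v : vertex (amalgam_tree A B C)) : int := match v with
  | inl x => D (repr x) 1
  | inr x => (D (repr x) 1%g + indicator C (repr x)^-1%g)%R
  end.
have chiA g : chi (inl (\pi_(lcosets A) g)) = D g 1.
  rewrite /chi; have [a Aa ->] := repr_lcoset A g.
  by rewrite derD (DA a) // addr0.
have chiB g : chi (inr (\pi_(lcosets B) g)) = (D g 1%g + indicator C g^-1%g)%R.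
  rewrite /chi; have [b Bb ->] := repr_lcoset B g.
  by rewrite derD (DB b) // /inner_derivation mulg1 invgM; ring.
have Dsupp g : coset_supported C (D g).
  apply: (amalgam_ind (P := fun g => coset_supported C (D g)) amal)
    => [|x a Aa Dx|x b Bb Dx].
  - by rewrite derivation1 //; apply: coset_supported0.
  - have -> : D (x * a) = D x; last by [].
    by apply/funext => y; rewrite derD (DA a) // addr0.
  have -> : D (x * b) = (fun y => D x y + (indicator C (x^-1 * y)%g
      - indicator C ((x * b)^-1 * y)%g))%R.
    by apply/funext => y; rewrite derD (DB b) // /inner_derivation invgM !mulgA.
  have mS := coset_supported_indicator C.
  apply: coset_supportedD => //; apply: coset_supportedD.
    exact: coset_supportedM.
  by apply: coset_supportedN; apply: coset_supportedM.
(* A path to the vertex [gB] may be taken through [gA], with [gC] as last edge; this is the extra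
   term of [u]. *)
apply: (@tree_halfspaces_not_one_ended C (amalgam_tree A B C)
  (\pi_(lcosets C) 1) chi D (fun v =>
    match v with
    | inl x => D (repr x)
    | inr x => fun y => (D (repr x) y + indicator C ((repr x)^-1 * y)%g)%R
    end) H2 endsC) => //.
- move=> W W0 WE.
  have WC g : W (inl (\pi_(lcosets A) g)) <-> W (inr (\pi_(lcosets B) g)).
    have [c Cc E] := repr_lcoset C g; have := WE (\pi_(lcosets C) g).
    by rewrite /= E !lcosetM ?CA ?CB.
  have WA g : W (inl (\pi_(lcosets A) g)).
    apply: (amalgam_ind (P := fun g => W (inl (\pi_(lcosets A) g))) amal)
      => [|x a Aa|x b Bb].
    - have [c Cc E] := repr_lcoset C 1; move: W0.
      by rewrite /= E lcosetM ?CA.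
    - by rewrite lcosetM.
    - by rewrite !WC lcosetM.
  by move=> [x|x]; rewrite -(reprK x) -?WC; apply: WA.
- have [c Cc E] := repr_lcoset C 1.
  by rewrite [source _]/= E chiA mul1g DA ?CA.
- have [c Cc E] := repr_lcoset C 1.
  rewrite [target _]/= E chiB mul1g DA ?CA // add0r.
  by rewrite /indicator gpredV Cc.
(* Along the edge [gC], [chi] jumps by the indicator of [C] at [g^-1]. *)
- move=> d dd0; rewrite [source _]/= [target _]/= chiA chiB.
  rewrite /indicator gpredV; have [Cd|] := boolP (_ \in C); last by rewrite addr0.
  case: dd0.
  by rewrite -[LHS]reprK; apply/esym/eqP; rewrite lcoset_eq invg1 mul1g.
- by move=> c x Cc; rewrite DA ?CA.
- move=> [x|x] //; apply: coset_supportedD => //.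
  exact: coset_supportedM (coset_supported_indicator C).
- move=> g [x|x]; first by rewrite [vertex_act _ _]/= chiA derD mulg1.
  by rewrite [vertex_act _ _]/= chiB derD mulg1 invgM addrA.
Qed.

(** The base edge [C] joins [A] to [t^-1 A], so D is zero on [A] and D(t^-1) is the indicator of
    [C]. *)
Lemma hnn_halfspaces_not_one_ended A C t :
  cohomology_vanishes (@group_ring_act G) 2 -> group_more_than_one_end C ->
  is_hnn A C t -> ~ halfspaces_one_ended (hnn_tree A C t).
Proof.
move=> H2 endsC hnn; have [CA tCA _] := hnn.
have mC c x : c \in C -> indicator C (c * x) = indicator C x.
  by move=> Cc; rewrite /indicator gpredMl.
have [D [derD DA Dt]] := hnn_derivation hnn mC.
pose chi (x : vertex (hnn_tree A C t)) : int := D (repr x) 1.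
have chiA g : chi (\pi_(lcosets A) g) = D g 1.
  rewrite /chi; have [a Aa ->] := repr_lcoset A g.
  by rewrite derD (DA a) // addr0.
(* The endpoint [g t^-1 A] of the edge [gC] is independent of the representative [g]. *)
have tA g c : c \in C ->
    \pi_(lcosets A) (g * c * t^-1) = \pi_(lcosets A) (g * t^-1).
  move=> Cc; have -> : g * c * t^-1 = g * t^-1 * (t * c * t^-1).
    by rewrite !mulgA mulgVK.
  by rewrite lcosetM ?tCA.
have Dsupp g : coset_supported C (D g).
  have mS := coset_supported_indicator C.
  have DtE x : D (x * t^-1) = (fun y => D x y + indicator C (x^-1 * y)%g)%R.
    by apply/funext => y; rewrite derD Dt.
  apply: (hnn_ind (P := fun g => coset_supported C (D g)) hnn)
    => [|x a Aa Dx|x].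
  - by rewrite derivation1 //; apply: coset_supported0.
  - have -> : D (x * a) = D x; last by [].
    by apply/funext => y; rewrite derD (DA a) // addr0.
  split=> Dx.
    by rewrite DtE; apply: coset_supportedD => //; apply: coset_supportedM.
  have -> : D x = (fun y => D (x * t^-1)%g y + - indicator C (x^-1 * y)%g)%R.
    by apply/funext => y; rewrite DtE addrK.
  apply: coset_supportedD => //; apply: coset_supportedN.
  exact: coset_supportedM.
apply: (@tree_halfspaces_not_one_ended C (hnn_tree A C t)
  (\pi_(lcosets C) 1) chi D
    (fun x => D (repr x)) H2 endsC) => //.
- move=> W W0 WE.
  have WA g : W (\pi_(lcosets A) g).
    apply: (hnn_ind (P := fun g => W (\pi_(lcosets A) g)) hnn)
      => [|x a Aa|x].
    - have [c Cc E] := repr_lcoset C 1; move: W0.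
      by rewrite /= E lcosetM ?CA.
    - by rewrite lcosetM.
    have [c Cc E] := repr_lcoset C x; have := WE (\pi_(lcosets C) x).
    by rewrite /= E tA // (lcosetM _ (CA _ Cc)).
  by move=> x; rewrite -(reprK x); apply: WA.
- have [c Cc E] := repr_lcoset C 1.
  by rewrite [source _]/= E chiA mul1g DA ?CA.
- have [c Cc E] := repr_lcoset C 1.
  rewrite [target _]/= E tA // mul1g chiA Dt.
  by rewrite /indicator gpred1.
- move=> d dd0; rewrite [source _]/= [target _]/= !chiA derD Dt mulg1.
  rewrite /indicator gpredV; have [Cd|] := boolP (_ \in C); last by rewrite addr0.
  case: dd0.
  by rewrite -[LHS]reprK; apply/esym/eqP; rewrite lcoset_eq invg1 mul1g.
- by move=> c x Cc; rewrite DA ?CA.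
- by move=> g x; rewrite [vertex_act _ _]/= chiA derD mulg1.
Qed.

End Trees.

(** * Duality groups of dimension at least 3, where degree 2 lies off the top degree *)

Theorem corollary1p7 (R : realType) (n : nat) (G : groupType)
    (n_ge3 : (3 <= n)%N) (dualityG : duality_group R n G) :
  ~ exists s : splitting G,
      [/\ nontrivial_splitting s,
          finitely_generated (edge_group s),
          group_more_than_one_end (edge_group s)
        & halfspaces_one_ended (bass_serre_tree s)].
Proof.
move=> [s [split_s _ endsC hs]]; have [_ vanish _] := dualityG.
have H2 : cohomology_vanishes (@group_ring_act G) 2.
  by apply: vanish => n2; rewrite -n2 in n_ge3.
case: s split_s endsC hs => [A B C|A C t] /= => [[amal _ _]|hnn] endsC.
  exact: amalgam_halfspaces_not_one_ended.
exact: hnn_halfspaces_not_one_ended.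
Qed.
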